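(* Let $j\ge0$ and assume $\overline{\sigma}_jf=\overline{I}_jf$ for all $f:\mathcal{S}\to[0,\infty]$. Let $\{f_n\}_{n\ge1}\subseteq\mathcal{L}_{\overline{\sigma}_j}$ be such that $\sum_{n\ge1}\|f_n\|_j<\infty$ (on $\mathcal{S}$). Then, on each conditional space $\mathcal{S}_{(S,j)}$, the partial sums $\sum_{n=1}^mf_n$ converge, as $m\to\infty$, a.e. on $\mathcal{S}_{(S,j)}$ and in the norm $\|\cdot\|_j(S)$ to $f\equiv\sum_{n\ge1}f_n$. Moreover, $f\in\mathcal{L}_{\overline{\sigma}_j}$ and $$\int_j\sum_{n\ge1}f_n\doteq\sum_{n\ge1}\int_jf_n .$$
   Context: Setting. Fix $s_0\in\mathbb{R}$ and a trajectory set $\mathcal{S}$, i.e. a (nonempty) set of real sequences $S=(S_i)_{i\ge0}$ with $S_0=s_0$. For $S\in\mathcal{S}$ and $j\ge0$ let $\mathcal{S}_{(S,j)}=\{\tilde S\in\mathcal{S}:\tilde S_i=S_i,\ 0\le i\le j\}$; the pair $(S,j)$ is called a node. Put $\Delta_iS=S_{i+1}-S_i$. For every node a set $\mathcal{H}_{(S,j)}$ of portfolios is given (depending only on the node, i.e. $\mathcal H_{(\tilde S,j)}=\mathcal H_{(S,j)}$ if $\tilde S\in\mathcal S_{(S,j)}$): its elements are sequences $H=(H_i)_{i\ge j}$ of functions $H_i:\mathcal{S}_{(S,j)}\to\mathbb{R}$ that are non-anticipative, i.e. $H_i(\tilde S)=H_i(\hat S)$ whenever $\tilde S_k=\hat S_k$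 for $j\le k\le i$. The following is assumed: (H.1) $\alpha\mathcal{H}_{(S,j)}+\mathcal{H}_{(S,j)}\subseteq\mathcal{H}_{(S,j)}$ for all $\alpha\ge0$; (H.2) every $(H_i)_{i\ge j}$ with each $H_i$ constant on $\mathcal{S}_{(S,j)}$ with value $-1$, $0$ or $1$ belongs to $\mathcal{H}_{(S,j)}$; (H.3) if $(H_i)_{i\ge j}\in\mathcal{H}_{(S,j)}$ and $k\ge j$ then $(H_i|_{\mathcal{S}_{(S,k)}})_{i\ge k}\in\mathcal{H}_{(S,k)}$; (H.4) if $(H_i)_{i\ge j}\in\mathcal{H}_{(S,j)}$, $k\ge j$, $G_i=H_i$ for $j\le i\le k$ and $G_i=0$ for $i>k$, then $G\in\mathcal{H}_{(S,j)}$. Elementary functions. For $V\in\mathbb{R}$, $H\in\mathcal{H}_{(S,j)}$, $n\ge j$ let $\Pi^{V,H}_{j,n}(\tilde S)=V+\sum_{i=j}^{n-1}H_i(\tilde S)\Delta_i\tilde S$ for $\tilde S\in\mathcal{S}_{(S,j)}$; $\mathcal{D}_{(S,j)}$ is the set of all such functions, $\mathcal{D}_{(S,j)}^+$ its non-negative elements, $\mathcal{D}_{(S,j)}^-=-\mathcal{D}_{(S,j)}^+$. Standing assumption 1 (local $0$-neutrality): $\sup_{\tilde S\in\mathcal{S}_{(S,j)}}(\tilde S_{j+1}-S_j)\ge0\ge\inf_{\tilde S\in\mathcal{S}_{(S,j)}}(\tilde S_{j+1}-S_j)$ at every node. Then for $f=\Pi^{V,H}_{j,n}\in\mathcal{D}_{(S,j)}^+$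 the value $I_jf(S)=V$ is well defined. Norm and a.e. $Q$ is the set of functions $\mathcal{S}\to[-\infty,\infty]$, $P\subseteq Q$ the non-negative ones. Conventions: $0\cdot\infty=0$, $\infty+(-\infty)=\infty$, $u-v=u+(-v)$, $\inf\emptyset=\infty$. For $f\in P$, $\overline{I}_jf(S)=\inf\{\sum_{m\ge1}V^m: f\le\sum_{m\ge1}f_m\text{ on }\mathcal{S}_{(S,j)},\ f_m=\Pi^{V^m,H^m}_{j,n_m}\in\mathcal{D}_{(S,j)}^+\}$; for $f\in Q$, $\|f\|_j(S)=\overline{I}_j|f|(S)$ and $\|f\|=\|f\|_0$ (a constant). $E\subseteq\mathcal{S}$ is null if $\|\mathbf{1}_E\|=0$; ''a.e.'' means off a null set, and $\doteq$ denotes equality a.e. A property holds a.e. on $\mathcal{S}_{(S,j)}$ if the set $E$ of points of $\mathcal{S}_{(S,j)}$ where it fails satisfies $\|\mathbf{1}_E\|_j(S)=0$. Functions on $\mathcal{S}_{(S,j)}$ that agree a.e. on $\mathcal{S}_{(S,j)}$ are identified in the normed space attached to $\|\cdot\|_j(S)$; the sum $f=\sum_nf_n$ is understood to take arbitrary values at points where the series does not converge. Conditional integral. For $f\in Q$, $\overline{\sigma}_jf(S)=\inf\{\sum_{m\ge0}V^m: f\le\sum_{m\ge0}f_m\text{ on }\mathcal{S}_{(S,j)},\ f_0=\Pi^{V^0,H^0}_{j,n_0}\in\mathcal{D}_{(S,j)}^-,\ f_m=\Pi^{V^m,H^m}_{j,n_m}\in\mathcal{D}_{(S,j)}^+\ (m\ge1)\}$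 (for $f_0\in\mathcal D_{(S,j)}^-=-\mathcal D_{(S,j)}^+$, $H^0$ is the negative of a portfolio and $V^0=-I_j(-f_0)(S)$), and $\underline{\sigma}_jf=-\overline{\sigma}_j(-f)$. Standing assumption 2: $\overline{\sigma}_j0=0$ on $\mathcal{S}$ for all $j\ge0$. $\mathcal{L}_{\overline{\sigma}_j}=\{f\in Q:\overline{\sigma}_jf-\underline{\sigma}_jf=0\text{ a.e.}\}$, and $\int_jf=\overline{\sigma}_jf$ for $f\in\mathcal{L}_{\overline{\sigma}_j}$. *)

(* Defs.v *)
From HB Require Import structures.
From mathcomp Require Export all_boot all_order all_algebra.
From mathcomp Require Export all_classical all_reals all_analysis.
Export Order.TTheory GRing.Theory Num.Theory numFieldNormedType.Exports.

Set Implicit Arguments.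
Unset Strict Implicit.
Unset Printing Implicit Defensive.

#[export] Set Implicit Arguments.
#[export] Unset Strict Implicit.
#[export] Unset Printing Implicit Defensive.

#[global] Open Scope classical_set_scope.
#[global] Open Scope ring_scope.

(** Arithmetic of [\bar R].  The convention here is [+oo + -oo = +oo], which is
    that of the dual addition [(_ + _)%dE] and not of [(_ + _)%E].  The latter
    only occurs below in series whose terms are non-negative, up to one real
    term, where both additions agree. *)

Definition agree (R : realType) (X : set (nat -> R)) (S : X) (j : nat) : set X :=
  [set S' | forall i, (i <= j)%N -> val S' i = val S i].

(** [portf S j] is a set of functions [H i : agree S j -> R] ([j <= i]).  Its
    elements are encoded as [H : nat -> trajs -> R], whose values at [i < j] or
    outside [agree S j] carry no information: [portf_ext].  Under this encoding,
    restricting [H] to a later node leaves it unchanged: [portf_restr]. *)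
Record market (R : realType) := Market {
  s0 : R ;
  trajs : set (nat -> R) ;
  trajs_neq0 : trajs !=set0 ;
  trajs_start : forall S, trajs S -> S 0%N = s0 ;
  portf : trajs -> nat -> set (nat -> trajs -> R) ;
  portf_ext : forall (S : trajs) (j : nat) (H G : nat -> trajs -> R),
    (forall i S', (j <= i)%N -> agree S j S' -> H i S' = G i S') ->
    portf S j H -> portf S j G ;
  portf_node : forall (S S' : trajs) (j : nat),
    agree S j S' -> portf S' j = portf S j ;
  portf_nonanticipative : forall (S : trajs) (j : nat) (H : nat -> trajs -> R),
    portf S j H ->
    forall i S1 S2, (j <= i)%N -> agree S j S1 -> agree S j S2 ->
      (forall k, (j <= k <= i)%N -> val S1 k = val S2 k) ->
      H i S1 = H i S2 ;
  portf_cone : forall (S : trajs) (j : nat) (a : R) (H G : nat -> trajs -> R),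
    0 <= a -> portf S j H -> portf S j G ->
    portf S j (fun i S' => a * H i S' + G i S') ;
  portf_const : forall (S : trajs) (j : nat) (c : nat -> R),
    (forall i, (j <= i)%N -> [\/ c i = -1, c i = 0 | c i = 1]) ->
    portf S j (fun i _ => c i) ;
  portf_restr : forall (S : trajs) (j k : nat) (H : nat -> trajs -> R),
    (j <= k)%N -> portf S j H -> portf S k H ;
  portf_stop : forall (S : trajs) (j k : nat) (H : nat -> trajs -> R),
    (j <= k)%N -> portf S j H ->
    portf S j (fun i S' => if (i <= k)%N then H i S' else 0)
}.

Section market_theory.
Variables (R : realType) (M : market R).
Local Notation traj := (trajs M).
Implicit Types (S : traj) (j n : nat) (f : traj -> \bar R).

Definition wealth j n (V : R) (H : nat -> traj -> R) (S' : traj) : R :=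
  V + \sum_(j <= i < n) H i S' * (val S' i.+1 - val S' i).

(** The restriction of [g] to [agree S j] is a non-negative elementary function
    at the node [(S, j)], with [I_j g(S) = V]. *)
Definition pos_elementary S j (V : R) (g : traj -> R) : Prop :=
  (forall S', agree S j S' -> 0 <= g S') /\
  exists (H : nat -> traj -> R) (n : nat),
    [/\ portf S j H, (j <= n)%N &
        forall S', agree S j S' -> g S' = wealth j n V H S'].

Definition locally_0_neutral : Prop := forall S j,
  (0 <= ereal_sup [set (val S' j.+1 - val S j)%:E | S' in agree S j])%E /\
  (ereal_inf [set (val S' j.+1 - val S j)%:E | S' in agree S j] <= 0)%E.

Definition Iup j f S : \bar R :=
  ereal_inf [set x | exists (V : nat -> R) (g : nat -> traj -> R),
    [/\ forall m, pos_elementary S j (V m) (g m),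
        forall S', agree S j S' -> (f S' <= \sum_(m <oo) (g m S')%:E)%E &
        x = (\sum_(m <oo) (V m)%:E)%E]].

Definition cnorm j f S : \bar R := Iup j (fun S' => `|f S'|%E) S.

(** [cnorm 0 f] is a constant function, since [agree S 0] is the whole space. *)
Definition null (E : set traj) : Prop :=
  forall S, cnorm 0 (fun S' => (\1_E S')%:E) S = 0%E.

Definition ae (P : set traj) : Prop := null (~` P).

Definition ae_at S j (P : set traj) : Prop :=
  cnorm j (fun S' => (\1_(agree S j `\` P) S')%:E) S = 0%E.

(** The term of index [0] ranges over [- g0], with [g0] non-negative elementary;
    the indices [m >= 1] are shifted to [m >= 0]. *)
Definition sigma_up j f S : \bar R :=
  ereal_inf [set x | exists (V0 : R) (g0 : traj -> R)
                            (V : nat -> R) (g : nat -> traj -> R),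
    [/\ pos_elementary S j V0 g0,
        forall m, pos_elementary S j (V m) (g m),
        forall S', agree S j S' ->
          (f S' <= (- g0 S')%:E + \sum_(m <oo) (g m S')%:E)%E &
        x = ((- V0)%:E + \sum_(m <oo) (V m)%:E)%E]].

Definition sigma_low j f S : \bar R := (- sigma_up j (fun S' => - f S') S)%E.

Definition cintegrable j f : Prop :=
  ae [set S | (sigma_up j f S - sigma_low j f S)%dE = 0%E].

(** Meaningful for [cintegrable j f] only. *)
Definition cintegral j f : traj -> \bar R := sigma_up j f.

End market_theory.

Definition psum (R : realType) (u : nat -> \bar R) (m : nat) : \bar R :=
  (\sum_(n < m) u n)%dE.

(** Convergence of a series to a real number.  It forces every term to be
    finite, since an infinite partial sum makes all later ones infinite. *)
Definition sums_to (R : realType) (u : nat -> \bar R) (x : \bar R) : Prop :=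
  x \is a fin_num /\ psum u @ \oo --> x.

(* Main.v *)
From mathcomp Require Import lra.
Require Import Defs.
Import DualAddTheory.

(** This is the Beppo Levi theorem for a superhedging functional: everything
    rests on countable subadditivity of the upper integral [Iup], and on the
    conditional integral being squeezed between [sigma_up] and [sigma_low].

    Fix a node [(S, j)].  The assumption [sigma_up j 0 = 0] rules out
    non-negative elementary functions of negative price
    ([pos_elementary_ge0]), so [Iup] is non-negative, and putting countably
    many covers side by side makes it countably subadditive
    ([Iup_sigma_subadditive]).  Hence [g := \sum_n `|f_ n|] has
    [Iup g <= \sum_n cnorm (f_ n) < +oo].  A cover of [g] of finite total price
    still covers an infinite value after its first [n] terms are dropped, and
    the price of these tails tends to [0]; so the function equal to [+oo] where
    [g] is infinite and to [0] elsewhere has zero upper integral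
    ([Iup_pinfty]).  Where [g] is finite the series converges absolutely, to
    [f], and the distance from the [m]-th partial sum to [f] is at most the tail
    [\sum_(n >= m) `|f_ n|].  This gives the convergence almost everywhere and
    the bound of the norm of the difference by the tail of the numerical series
    ([cnorm_psum_sub]), which tends to [0].

    For the integrals, let the node be one at which every [f_ n] satisfies
    [sigma_up (f_ n) = sigma_low (f_ n) = r n], and let [e m] be the norm of the
    difference between [f] and its [m]-th partial sum.  The functional
    [sigma_up] is subadditive and bounded by the norm, whence
    [sigma_up f <= \sum_(n < m) r n + e m] and
    [sigma_up (- f) <= - \sum_(n < m) r n + e m], while
    [0 <= sigma_up f + sigma_up (- f)].  As [e m] tends to [0], [sigma_up f] and
    [sigma_low f] both equal the sum of the [r n] ([sigma_up_sums_to]).  The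
    nodes at which some [f_ n] fails this equality form a null set, being a
    countable union of null sets ([ae_countable]). *)

(** * Series of extended reals *)

Lemma nat_pairing : exists e : nat -> nat * nat, set_bij setT setT e.
Proof.
have /card_esym/ppcard_eqP[e] := card_nat2.
by exists e; exact: 'bij_e.
Qed.

(** Enumerating pairs turns a sequence of covers into a single cover. *)
Lemma nneseries_pairing (R : realType) (e : nat -> nat * nat)
    (a : nat -> nat -> \bar R) : set_bij setT setT e ->
  (forall n m, 0 <= a n m)%E ->
  (\sum_(k <oo) a (e k).1 (e k).2 = \sum_(n <oo) \sum_(m <oo) a n m)%E.
Proof.
move=> bij_e a0; rewrite nneseries_esumT//.
rewrite -(@reindex_esum _ _ _ setT setT e (fun p => a p.1 p.2))//.
rewrite nneseries_esumT; last by move=> n; exact: nneseries_ge0.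
rewrite (_ : [set: nat * nat] = [set: nat] `*`` (fun=> setT)); last first.
  by apply/seteqP; split.
rewrite -esum_esum//; apply: eq_esum => n _.
by rewrite nneseries_esumT.
Qed.

(** Countable subadditivity will be applied to families with one exceptional
    member in front. *)
Lemma nneseries_cons (R : realType) (a : \bar R) (u : nat -> \bar R) :
  (0 <= a)%E -> (forall n, 0 <= u n)%E ->
  (\sum_(n <oo) (if n is k.+1 then u k else a) = a + \sum_(n <oo) u n)%E.
Proof.
move=> a0 u0; rewrite (@nneseries_split _ _ 0 1); last by case.
rewrite big_nat1 -nneseries_addn; last by case.
by congr (_ + _)%E; rewrite add0n; apply: eq_eseriesr => n _; rewrite addn1.
Qed.

Lemma nneseries_ge_term (R : realType) (u : nat -> \bar R) n :
  (forall k, 0 <= u k)%E -> (u n <= \sum_(k <oo) u k)%E.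
Proof.
move=> u0; rewrite (@nneseriesD1 _ u n xpredT)//; apply: leeDl.
exact: nneseries_ge0.
Qed.

Lemma psumE (R : realType) (u : nat -> R) m :
  psum (EFin \o u) m = (series u m)%:E.
Proof.
rewrite /psum /series/=; elim: m => [|m IH]; first by rewrite big_ord0 big_geq.
by rewrite big_ord_recr/= IH big_nat_recr.
Qed.

(** Absolute convergence; the bound on the remainder is the limit in [k] of the
    triangle inequality for the terms between [m] and [k]. *)
Lemma sums_to_abs (R : realType) (u : nat -> \bar R) :
  (\sum_(n <oo) `|u n| < +oo)%E ->
  exists2 x, sums_to u x &
    forall m, (`|psum u m - x|%dE <= \sum_(m <= n <oo) `|u n|)%E.
Proof.
move=> uoo; have ufin n : u n \is a fin_num.
  rewrite -abse_fin_num ge0_fin_numE//.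
  by apply: le_lt_trans uoo; exact: (@nneseries_ge_term _ (fun n => `|u n|%E)).
pose r n := fine (u n).
have ur : u = EFin \o r by apply/funext => n /=; rewrite fineK.
have r_cvg : cvgn (series r).
  apply: normed_cvg; apply: nnseries_is_cvg => [n|].
    exact: normr_ge0.
  by move: uoo; rewrite ur.
exists (limn (series r))%:E.
  split=> //; rewrite ur (_ : psum _ = EFin \o series r).
    by apply: cvg_EFin => //; exact: nearW.
  by apply/funext => m; exact: psumE.
move=> m; rewrite {1}ur psumE abse_EFin.
have dist_cvg : `|series r m - series r k|%:E @[k --> \oo] -->
    `|series r m - limn (series r)|%:E.
  apply: cvg_EFin; first exact: nearW.
  by apply: cvg_norm; apply: cvgB => //; exact: cvg_cst.
rewrite -(cvg_lim _ dist_cvg)//; apply: lime_le.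
  by apply/cvg_ex; eexists; exact: dist_cvg.
near=> k; have mk : (m <= k)%N by near: k; exact: nbhs_infty_ge.
rewrite distrC sub_series_geq//.
apply: (@le_trans _ _ (\sum_(m <= n < k) `|u n|)%E); last first.
  exact: nneseries_lim_ge.
by rewrite ur/= sumEFin lee_fin; exact: ler_norm_sum.
Unshelve. all: by end_near. Qed.

(** * Arithmetic of the dual addition *)

Section dual_addition.
Variable R : realType.
Implicit Types x y : \bar R.

Lemma dsubee_ge0 x : (0 <= (x - x)%dE)%E.
Proof.
by case: x => [r| |]; [rewrite -dEFinB subrr|rewrite /GRing.add/= leey..].
Qed.

(** The convention [+oo + -oo = +oo] is what makes this hold without any
    finiteness condition; with the other convention it fails at
    [x = y = +oo]. *)
Lemma le_dadd_dsub x y : (x <= (y + (x - y))%dE)%E.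
Proof.
case: x y => [r| |] [s| |]; rewrite /GRing.add/= ?leey ?leNye//.
by rewrite lee_fin addrC subrK.
Qed.

Lemma oppe_dadd_le x y : (- (x + y)%dE <= (- x - y)%dE)%E.
Proof.
case: x y => [r| |] [s| |]; rewrite /GRing.add/= ?leey ?leNye//.
by rewrite lee_fin opprD.
Qed.

Lemma abse_dsubC x y : `|(x - y)%dE|%E = `|(y - x)%dE|%E.
Proof.
case: x y => [r| |] [s| |]; rewrite /GRing.add//=.
by rewrite distrC.
Qed.

End dual_addition.

(** * Non-negative elementary functions *)

Section node.
Variables (R : realType) (M : market R) (S : trajs M) (j : nat).
Local Notation traj := (trajs M).
Implicit Types V : R.

Lemma portf0 : portf S j (fun _ _ => 0).
Proof. by apply: (@portf_const _ _ _ _ (fun=> 0)) => i _; apply: Or32. Qed.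

(** For [n <= j] the truncation is [0] on all relevant indices, a case that
    [portf_stop] does not cover. *)
Lemma portf_truncate n (H : nat -> traj -> R) : portf S j H ->
  portf S j (fun i S' => if (i < n)%N then H i S' else 0).
Proof.
move=> pH; have [nj|] := leqP n j.
  apply: portf_ext portf0 => i S' ji _.
  by rewrite ltnNge (leq_trans nj ji).
case: n => // n jn.
exact: portf_stop.
Qed.

Lemma wealth_truncate n n' V (H : nat -> traj -> R) S' : (j <= n <= n')%N ->
  wealth j n' V (fun i S' => if (i < n)%N then H i S' else 0) S' =
  wealth j n V H S'.
Proof.
move=> /andP[jn nn']; rewrite /wealth (big_cat_nat jn nn')/=.
rewrite [X in _ + (_ + X)]big_nat_cond [X in _ + (_ + X)]big1 ?addr0; last first.
  by move=> i /andP[/andP[ni _] _]; rewrite ltnNge ni/= mul0r.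
by congr (_ + _); apply: eq_big_nat => i /andP[_ ->].
Qed.

Lemma pos_elementary0 : pos_elementary S j 0 (fun _ : traj => 0).
Proof.
split=> //; exists (fun _ _ => 0), j; split=> //; first exact: portf0.
by move=> S' _; rewrite /wealth big_geq// addr0.
Qed.

(** The two maturities may differ: each portfolio is continued by [0] from its
    own maturity to the later one. *)
Lemma pos_elementaryD V V' (g g' : traj -> R) :
  pos_elementary S j V g -> pos_elementary S j V' g' ->
  pos_elementary S j (V + V') (fun S' => g S' + g' S').
Proof.
move=> [g0 [H [n [pH jn gE]]]] [g'0 [H' [n' [pH' jn' gE']]]].
split=> [S' SS'|]; first by rewrite addr_ge0 ?g0 ?g'0.
exists (fun i S' => 1 * (if (i < n)%N then H i S' else 0) +
                    (if (i < n')%N then H' i S' else 0)), (maxn n n').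
split=> [||S' SS']; first by apply: portf_cone => //; exact: portf_truncate.
  by rewrite leq_max jn.
rewrite gE// gE'// -(@wealth_truncate n (maxn n n')) ?jn ?leq_maxl//.
rewrite -(@wealth_truncate n' (maxn n n') V') ?jn' ?leq_maxr//.
rewrite /wealth addrACA -big_split/=; congr (_ + _).
by apply: eq_bigr => i _; rewrite mul1r mulrDl.
Qed.

End node.

(** * The upper integral and the upper conditional integral at a node *)

Section upper_integral.
Variables (R : realType) (M : market R) (S : trajs M) (j : nat).
Local Notation traj := (trajs M).
Implicit Types (f g h : traj -> \bar R) (V : R).
Hypothesis sigma0 : sigma_up j (fun _ : traj => 0%E) S = 0%E.

(** A negative price [V] would make [V] the price of a cover of [0], against
    [sigma0]. *)
Lemma pos_elementary_ge0 V (g : traj -> R) : pos_elementary S j V g -> 0 <= V.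
Proof.
move=> Vg; rewrite -lee_fin -[X in (X <= _)%E]sigma0; apply: ereal_inf_lbound.
exists 0, (fun=> 0), (fun m => if m is 0%N then V else 0),
  (fun m S' => if m is 0%N then g S' else 0); split.
- exact: pos_elementary0.
- by case=> // n; exact: pos_elementary0.
- move=> S' SS'; rewrite oppr0 add0e; apply: nneseries_ge0 => -[|n] _ _ //.
  by rewrite lee_fin; exact: Vg.1.
- rewrite oppr0 add0e; apply/esym/lim_near_cst => //.
  near=> n; have : (0 < n)%N by near: n; exact: nbhs_infty_gt.
  by move=> n0; rewrite -(prednK n0) big_nat_recl//= big1 ?adde0.
Unshelve. all: by end_near. Qed.

Lemma Iup_ge0 f : (0 <= Iup j f S)%E.
Proof.
apply: le_ereal_inf_tmp => x [V [g [pVg _ ->]]]; apply: nneseries_ge0 => m _ _.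
by rewrite lee_fin; exact: pos_elementary_ge0 (pVg m).
Qed.

Lemma Iup_le f (V : nat -> R) (g : nat -> traj -> R) :
  (forall m, pos_elementary S j (V m) (g m)) ->
  (forall S', agree S j S' -> (f S' <= \sum_(m <oo) (g m S')%:E)%E) ->
  (Iup j f S <= \sum_(m <oo) (V m)%:E)%E.
Proof. by move=> pVg fg; apply: ereal_inf_lbound; exists V, g. Qed.

Lemma Iup_cover f (x : R) : (Iup j f S < x%:E)%E ->
  exists (V : nat -> R) (g : nat -> traj -> R),
  [/\ forall m, pos_elementary S j (V m) (g m),
      forall S', agree S j S' -> (f S' <= \sum_(m <oo) (g m S')%:E)%E &
      (\sum_(m <oo) (V m)%:E < x%:E)%E].
Proof. by move/ereal_inf_lt => [y [V [g [? ? ->]]] ?]; exists V, g. Qed.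

Lemma le_Iup f g : (forall S', agree S j S' -> (f S' <= g S')%E) ->
  (Iup j f S <= Iup j g S)%E.
Proof.
move=> fg; apply: le_ereal_inf_tmp => x [V [h [pVh gh ->]]].
by apply: (@Iup_le f V h) => // S' SS'; apply: le_trans (fg _ SS') (gh _ SS').
Qed.

(** Cover each [h n] up to [e / 2 ^ (n + 1)] and enumerate all the covers along
    pairs. *)
Lemma Iup_sigma_subadditive f (h : nat -> traj -> \bar R) :
  (forall n S', agree S j S' -> (0 <= h n S')%E) ->
  (forall S', agree S j S' -> (f S' <= \sum_(n <oo) h n S')%E) ->
  (Iup j f S <= \sum_(n <oo) Iup j (h n) S)%E.
Proof.
move=> h0 fh; have [[n noo]|] := pselect (exists n, Iup j (h n) S = +oo%E).
  by rewrite (nneseries_pinfty _ _ noo) ?leey// => k _; exact: Iup_ge0.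
rewrite -forallNE => hoo; apply/lee_addgt0Pr => e e0.
have pe n : 0 < e / (2 ^ n.+1)%:R by rewrite divr_gt0// ltr0n expn_gt0.
pose cover n (Vg : (nat -> R) * (nat -> traj -> R)) :=
  [/\ forall m, pos_elementary S j (Vg.1 m) (Vg.2 m),
      forall S', agree S j S' -> (h n S' <= \sum_(m <oo) (Vg.2 m S')%:E)%E &
      (\sum_(m <oo) (Vg.1 m)%:E <=
         Iup j (h n) S + (e / (2 ^ n.+1)%:R)%:E)%E].
have [Vg Vg_cover] : {Vg & forall n, cover n (Vg n)}.
  apply: (@choice _ _ cover) => n.
  have fin : Iup j (h n) S \is a fin_num.
    by rewrite ge0_fin_numE ?Iup_ge0// ltey; apply/eqP.
  have [|V [g [pVg hg /ltW Vlt]]] :=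
    @Iup_cover (h n) (fine (Iup j (h n) S) + e / (2 ^ n.+1)%:R).
    by rewrite EFinD fineK// lteDl// lte_fin pe.
  exists (V, g); split=> //.
  by rewrite -[in leRHS](fineK fin).
have [k bij_k] := nat_pairing.
rewrite (le_trans _ (epsilon_trick xpredT (fun n => Iup_ge0 (h n)) (ltW e0)))//.
apply: (@le_trans _ _ (\sum_(n <oo) \sum_(m <oo) ((Vg n).1 m)%:E)%E).
  rewrite -(nneseries_pairing (a := fun n m => ((Vg n).1 m)%:E) bij_k).
    apply: (@Iup_le f _ (fun m => (Vg (k m).1).2 (k m).2)) => [m|S' SS'].
      by have [+ _ _] := Vg_cover (k m).1; exact.
    have g0 n m : (0 <= ((Vg n).2 m S')%:E)%E.
      by rewrite lee_fin; have [+ _ _] := Vg_cover n; move=> /(_ m)[+ _]; exact.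
    rewrite (nneseries_pairing (a := fun n m => ((Vg n).2 m S')%:E) bij_k)//.
    apply: le_trans (fh _ SS') _; apply: lee_nneseries => n *.
      exact: h0.
    by have [_ + _] := Vg_cover n; exact.
  move=> n m; rewrite lee_fin; have [+ _ _] := Vg_cover n.
  by move=> /(_ m); exact: pos_elementary_ge0.
apply: lee_nneseries => n *; last by have [] := Vg_cover n.
apply: nneseries_ge0 => m _ _; rewrite lee_fin; have [+ _ _] := Vg_cover n.
by move=> /(_ m); exact: pos_elementary_ge0.
Qed.

(** The tails of a cover of [g] of finite price: the dropped terms are finitely
    many real numbers, so a tail still sums to [+oo] wherever [g] is [+oo]. *)
Lemma Iup_pinfty g :
  (forall S', agree S j S' -> (0 <= g S')%E) -> (Iup j g S < +oo)%E ->
  Iup j (fun S' => if g S' == +oo%E then +oo%E else 0%E) S = 0%E.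
Proof.
move=> g0 goo; have fin : Iup j g S \is a fin_num by rewrite ge0_fin_numE// Iup_ge0.
have [|V [h [pVh gh Vlt]]] := @Iup_cover g (fine (Iup j g S) + 1).
  by rewrite EFinD fineK// lteDl// lte_fin.
apply/eqP; rewrite eq_le Iup_ge0 andbT.
have V0 m : (0 <= (V m)%:E)%E by rewrite lee_fin; exact: pos_elementary_ge0 (pVh m).
have Vtail := nneseries_tail_cvg (lt_trans Vlt (ltry _)) (fun m _ => V0 m).
rewrite -[leRHS](cvg_lim _ Vtail)//; apply: lime_ge; first by apply/cvg_ex; exists 0%E.
apply: nearW => n; rewrite -nneseries_addn//.
apply: (@Iup_le _ (fun m => V (m + n)%N) (fun m => h (m + n)%N)) => // S' SS'.
have h0 m : (0 <= (h m S')%:E)%E by rewrite lee_fin; exact: (pVh m).1.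
case: ifPn => [/eqP gSoo|_]; last by apply: nneseries_ge0 => m _ _; exact: h0.
have := gh _ SS'; rewrite gSoo leye_eq (nneseries_addn n (f := fun m => (h m S')%:E))//.
rewrite (@nneseries_split _ _ 0 n)// add0n sumEFin.
by case: (\sum_(n <= k <oo) _)%E.
Qed.

Lemma sigma_up_le_Iup f : (sigma_up j f S <= Iup j f S)%E.
Proof.
apply: le_ereal_inf_tmp => x [V [g [pVg fg ->]]]; apply: ereal_inf_lbound.
exists 0, (fun=> 0), V, g; split=> //; first exact: pos_elementary0.
  by move=> S' SS'; rewrite oppr0 add0e; exact: fg.
by rewrite oppr0 add0e.
Qed.

Lemma sigma_up_le_cnorm f : (sigma_up j f S <= cnorm j f S)%E.
Proof.
apply: le_trans (sigma_up_le_Iup f) _; apply: le_Iup => S' _.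
exact: lee_abs.
Qed.

(** Real bounds [x] and [y] keep the lemma free of any convention on
    [sigma_up g + sigma_up h], and allow [sigma_up] to be [-oo]. *)
Lemma sigma_up_subadditive f g h (x y : R) :
  (forall S', agree S j S' -> (f S' <= g S' + h S')%dE) ->
  (sigma_up j g S <= x%:E)%E -> (sigma_up j h S <= y%:E)%E ->
  (sigma_up j f S <= (x + y)%:E)%E.
Proof.
move=> fgh gx hy; apply/lee_addgt0Pr => e e0.
have e20 : 0 < e / 2 by rewrite divr_gt0.
have /ereal_inf_lt[_ [V0 [g0 [V [u [pV0 pV gu ->]]]]] Vx] :
    (sigma_up j g S < (x + e / 2)%:E)%E.
  by apply: le_lt_trans gx _; rewrite lte_fin ltrDl.
have /ereal_inf_lt[_ [W0 [h0 [W [v [pW0 pW hv ->]]]]] Wy] :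
    (sigma_up j h S < (y + e / 2)%:E)%E.
  by apply: le_lt_trans hy _; rewrite lte_fin ltrDl.
have addE (a b : R) (c d : nat -> R) :
    (forall n, 0 <= c n) -> (forall n, 0 <= d n) ->
    ((- (a + b))%:E + \sum_(n <oo) (c n + d n)%:E =
     ((- a)%:E + \sum_(n <oo) (c n)%:E) + ((- b)%:E + \sum_(n <oo) (d n)%:E))%E.
  move=> c0 d0; rewrite addeACA -EFinD -opprD; congr (_ + _)%E.
  by rewrite -nneseriesD//; move=> *; rewrite lee_fin.
apply: (@le_trans _ _ ((- (V0 + W0))%:E + \sum_(m <oo) (V m + W m)%:E)%E).
  apply: ereal_inf_lbound; exists (V0 + W0), (fun S' => g0 S' + h0 S').
  exists (fun m => V m + W m), (fun m S' => u m S' + v m S'); split=> //.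
  - exact: pos_elementaryD.
  - by move=> m; exact: pos_elementaryD.
  - move=> S' SS'; apply: (le_trans (fgh _ SS')).
    have u0 m : 0 <= u m S' by exact: (pV m).1.
    have v0 m : 0 <= v m S' by exact: (pW m).1.
    rewrite addE//; apply: (le_trans (lee_dD (gu _ SS') (hv _ SS'))).
    have : (0 <= \sum_(m <oo) (u m S')%:E)%E.
      by apply: nneseries_ge0 => *; rewrite lee_fin.
    have : (0 <= \sum_(m <oo) (v m S')%:E)%E.
      by apply: nneseries_ge0 => *; rewrite lee_fin.
    (* Neither summand is [-oo], so both additions agree. *)
    by case: (\sum_(_ <= _ <oo) _)%E => [a| |] //; case: (\sum_(_ <= _ <oo) _)%E.
rewrite addE => [|n|n]; [|exact: pos_elementary_ge0 (pV n)
                        |exact: pos_elementary_ge0 (pW n)].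
rewrite (le_trans (leeD (ltW Vx) (ltW Wy)))//.
by rewrite -!EFinD lee_fin addrACA -splitr.
Qed.

Lemma sigma_up_addN_ge0 f (x y : R) : (sigma_up j f S <= x%:E)%E ->
  (sigma_up j (fun S' => - f S')%E S <= y%:E)%E -> 0 <= x + y.
Proof.
move=> fx fy; rewrite -lee_fin -[X in (X <= _)%E]sigma0.
apply: sigma_up_subadditive fx fy => S' _.
exact: dsubee_ge0.
Qed.

Lemma sigma_up_fin f (x y : R) : (sigma_up j f S <= x%:E)%E ->
  (sigma_up j (fun S' => - f S')%E S <= y%:E)%E ->
  exists a b, [/\ sigma_up j f S = a%:E,
    sigma_up j (fun S' => - f S')%E S = b%:E & 0 <= a + b].
Proof.
move=> fx fy; have := sigma_up_addN_ge0 (f := f).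
case: (sigma_up j f S) fx => [a|//|] fx; last first.
  by move=> /(_ (- y - 1) y (leNye _) fy); rewrite addrAC addNr sub0r oppr_ge0 ler10.
case: (sigma_up j _ S) fy => [b|//|] fy.
  by move=> /(_ a b (lexx _) (lexx _)); exists a, b.
by move=> /(_ a (- a - 1) (lexx _) (leNye _)); rewrite addrA subrr sub0r oppr_ge0 ler10.
Qed.

End upper_integral.

(** * A norm-summable series at a node *)

Section series_at_node.
Variables (R : realType) (M : market R) (S : trajs M) (j : nat).
Local Notation traj := (trajs M).
Hypothesis sigma0 : sigma_up j (fun _ : traj => 0%E) S = 0%E.
Variables (f_ : nat -> traj -> \bar R) (f : traj -> \bar R).
Hypothesis f_sum : (\sum_(n <oo) cnorm j (f_ n) S < +oo)%E.
Hypothesis fE : forall S' x, agree S j S' ->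
  sums_to (fun n => f_ n S') x -> f S' = x.

(** Off the points of absolute convergence [f] is arbitrary, so only an infinite
    penalty dominates its distance to the partial sums there. *)
Let blowup S' : \bar R :=
  if (\sum_(n <oo) `|f_ n S'|)%E == +oo%E then +oo%E else 0%E.

Lemma blowup_or_sums_to S' : agree S j S' ->
  blowup S' = +oo%E \/
  [/\ blowup S' = 0%E, sums_to (fun n => f_ n S') (f S') &
    forall m, (`|psum (fun n => f_ n S') m - f S'|%dE <=
               \sum_(m <= n <oo) `|f_ n S'|)%E].
Proof.
move=> SS'; rewrite /blowup; case: eqP => [_|/eqP foo]; [by left|right].
have /sums_to_abs[x xsum xle] : (\sum_(n <oo) `|f_ n S'| < +oo)%E by rewrite ltey.
by rewrite (fE SS' xsum).
Qed.

Lemma Iup_blowup : Iup j blowup S = 0%E.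
Proof.
apply: Iup_pinfty => // [S' _|]; first exact: nneseries_ge0.
apply: le_lt_trans f_sum; apply: Iup_sigma_subadditive => //.
Qed.

Lemma ae_at_sums_to : ae_at S j [set S' | sums_to (fun n => f_ n S') (f S')].
Proof.
apply/eqP; rewrite eq_le Iup_ge0// andbT -Iup_blowup.
apply: le_Iup => // S' SS'; rewrite indicE.
case: (blowup_or_sums_to SS') => [->|[-> fS' _]]; first by rewrite leey.
by rewrite memNset//= ?normr0// => -[].
Qed.

(** The pointwise distance is at most [blowup] plus the tail of the series of
    absolute values, to which countable subadditivity applies. *)
Lemma cnorm_psum_sub m :
  (cnorm j (fun S' => (psum (fun n => f_ n S') m - f S')%dE) S <=
   \sum_(m <= n <oo) cnorm j (f_ n) S)%E.
Proof.
have cnorm0 n : (0 <= cnorm j (f_ n) S)%E by exact: Iup_ge0.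
rewrite -nneseries_addn// -[leRHS]add0e -[X in (_ <= X + _)%E]Iup_blowup.
rewrite -(@nneseries_cons _ _ (fun n => cnorm j (f_ (n + m)%N) S))//;
  last exact: Iup_ge0.
pose h n S' := if n is k.+1 then `|f_ (k + m)%N S'|%E else blowup S'.
rewrite (@eq_eseriesr _ _ (fun n => Iup j (h n) S)); last by case.
have blowup0 S' : (0 <= blowup S')%E by rewrite /blowup; case: ifP.
apply: Iup_sigma_subadditive => // [[|n] S' _ //=|S' SS'].
rewrite (@eq_eseriesr _ _
  (fun n => if n is k.+1 then `|f_ (k + m)%N S'|%E else blowup S')); last by case.
rewrite (@nneseries_cons _ _ (fun k => `|f_ (k + m)%N S'|%E))//.
rewrite (nneseries_addn m (f := fun k => `|f_ k S'|%E))//.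
case: (blowup_or_sums_to SS') => [->|[-> _]]; last by rewrite add0e; exact.
rewrite addye ?leey//.
have := @nneseries_ge0 _ (fun n => `|f_ n S'|%E) xpredT m.
by case: (\sum_(_ <= _ <oo) _)%E => // /(_ (fun _ _ _ => abse_ge0 _)).
Qed.

Lemma cnorm_psum_cvg :
  cnorm j (fun S' => (psum (fun n => f_ n S') m - f S')%dE) S
    @[m --> \oo] --> 0%E.
Proof.
apply: (@squeeze_cvge _ _ _ _ (fun=> 0%E) _
  (fun m => \sum_(m <= n <oo) cnorm j (f_ n) S)%E).
- by apply: nearW => m; rewrite Iup_ge0//= cnorm_psum_sub.
- exact: cvg_cst.
- by apply: nneseries_tail_cvg => // n _; exact: Iup_ge0.
Qed.

Lemma sigma_up_psum (r : nat -> R) :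
  (forall n, sigma_up j (f_ n) S = (r n)%:E /\
    sigma_up j (fun S' => - f_ n S')%E S = (- r n)%:E) ->
  forall m,
    (sigma_up j (fun S' => psum (fun n => f_ n S') m) S <= (series r m)%:E)%E /\
    (sigma_up j (fun S' => - psum (fun n => f_ n S') m)%E S <=
      (- series r m)%:E)%E.
Proof.
move=> sigmaE; elim => [|m [IH IHN]].
  rewrite /series/= big_geq// oppr0; split.
    by rewrite (_ : (fun _ => _) = (fun=> 0%E)) ?sigma0//;
      apply/funext => S'; rewrite /psum big_ord0.
  by rewrite (_ : (fun _ => _) = (fun=> 0%E)) ?sigma0//;
    apply/funext => S'; rewrite /psum big_ord0 oppe0.
have psumS S' : psum (fun n => f_ n S') m.+1 =
    (psum (fun n => f_ n S') m + f_ m S')%dE by rewrite /psum big_ord_recr.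
have [fm fmN] := sigmaE m.
rewrite seriesSr opprD; split.
  apply: (sigma_up_subadditive sigma0 _ IH (h := f_ m)); last by rewrite fm.
  by move=> S' _; rewrite psumS.
apply: (sigma_up_subadditive sigma0 _ IHN (h := fun S' => - f_ m S')%E).
  by move=> S' _; rewrite psumS; exact: oppe_dadd_le.
by rewrite fmN.
Qed.

Hypothesis f_int :
  forall n, (sigma_up j (f_ n) S - sigma_low j (f_ n) S)%dE = 0%E.

(** Each partial sum bounds [sigma_up f] from above and, through [- f], from
    below, with an error that tends to [0]. *)
Lemma sigma_up_sums_to :
  sums_to (fun n => sigma_up j (f_ n) S) (sigma_up j f S) /\
  (sigma_up j f S - sigma_low j f S)%dE = 0%E.
Proof.
have [r sigmaE] : exists r : nat -> R, forall n, sigma_up j (f_ n) S = (r n)%:E /\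
    sigma_up j (fun S' => - f_ n S')%E S = (- r n)%:E.
  exists (fun n => fine (sigma_up j (f_ n) S)) => n.
  have := f_int n; rewrite /sigma_low.
  case: (sigma_up j (f_ n) S) => [x| |]//; case: (sigma_up j _ S) => [y| |]//=.
  by move=> [/eqP]; rewrite subr_eq0 => /eqP->; rewrite opprK.
have sigma_psum := sigma_up_psum sigmaE.
pose e m := cnorm j (fun S' => (psum (fun n => f_ n S') m - f S')%dE) S.
have e_fin m : e m \is a fin_num.
  rewrite ge0_fin_numE; last exact: Iup_ge0.
  apply: le_lt_trans (cnorm_psum_sub m) (le_lt_trans _ f_sum).
  have cnorm0 k : (0 <= cnorm j (f_ k) S)%E by exact: Iup_ge0.
  by rewrite [leRHS](@nneseries_split _ _ 0 m)// add0n leeDr// sume_ge0.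
have fe m : (sigma_up j f S <= (series r m + fine (e m))%:E)%E.
  apply: (sigma_up_subadditive sigma0 _ (sigma_psum m).1
    (h := fun S' => f S' - psum (fun n => f_ n S') m)%dE).
    by move=> S' _; exact: le_dadd_dsub.
  rewrite fineK//; apply: le_trans (sigma_up_le_cnorm _ _ _) _.
  by apply: le_Iup => // S' _; rewrite abse_dsubC.
have feN m : (sigma_up j (fun S' => - f S')%E S <= (- series r m + fine (e m))%:E)%E.
  apply: (sigma_up_subadditive sigma0 _ (sigma_psum m).2
    (h := fun S' => psum (fun n => f_ n S') m - f S')%dE).
    move=> S' _; have := le_dadd_dsub (- f S') (- psum (fun n => f_ n S') m).
    by rewrite oppeK [X in (_ + X)%dE]addrC.
  by rewrite fineK//; exact: sigma_up_le_cnorm.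
have [a [b [fa fb ab]]] := sigma_up_fin sigma0 (fe 0%N) (feN 0%N).
have dist_e m : `|series r m - a| <= fine (e m).
  have := fe m; have := feN m; rewrite fa fb !lee_fin ler_norml; lra.
have e0 : fine (e m) @[m --> \oo] --> (0 : R) by exact/fine_cvg/cnorm_psum_cvg.
have ab0 : a + b = 0.
  apply/eqP; rewrite eq_le ab andbT.
  have -> : 0 = lim (fine (e m) *+ 2 @[m --> \oo]) :> R.
    by apply/esym/cvg_lim => //; rewrite -[X in _ --> X](mul0rn _ 2); exact: cvgMn.
  apply: limr_ge; first by apply/cvg_ex; exists (0 *+ 2); exact: cvgMn.
  apply: nearW => m; have := fe m; have := feN m.
  rewrite fa fb !lee_fin mulr2n; lra.
split.
  split; first by rewrite fa.
  rewrite fa (_ : psum _ = EFin \o series r); last first.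
    apply/funext => m; rewrite [RHS]/= -psumE; congr psum.
    by apply/funext => n; case: (sigmaE n).
  apply: cvg_EFin; first exact: nearW.
  apply/cvgrPdist_le => d d0.
  have /cvgrPdist_le/(_ _ d0) := e0; apply: filterS => m /=.
  rewrite sub0r normrN distrC => /(le_trans (ler_norm _)).
  exact: le_trans (dist_e m).
by rewrite /sigma_low fa fb oppeK -dEFinD ab0.
Qed.

End series_at_node.

(** * Countable intersections of sets of full measure *)

Section almost_everywhere.
Variables (R : realType) (M : market R).
Local Notation traj := (trajs M).
Hypothesis sigma0 : forall S, sigma_up 0 (fun _ : traj => 0%E) S = 0%E.

Lemma ae_sub (P Q : set traj) : P `<=` Q -> ae P -> ae Q.
Proof.
move=> PQ aeP S; apply/eqP; rewrite eq_le Iup_ge0// andbT -(aeP S).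
apply: le_Iup => // S' _; rewrite !gee0_abs ?lee_fin// !indicE ler_nat.
case: (S' \in ~` Q) / (boolP (S' \in ~` Q)) => // /set_mem QS'.
by rewrite mem_set// => /PQ.
Qed.

Lemma ae_countable (P : nat -> set traj) :
  (forall n, ae (P n)) -> ae (\bigcap_n P n).
Proof.
move=> aeP S; apply/eqP; rewrite eq_le Iup_ge0// andbT.
rewrite -[leRHS](@eseries0 _ (fun n => cnorm 0 (fun S' => (\1_(~` P n) S')%:E) S)
  0 xpredT); last by move=> n _ _; exact: aeP.
apply: Iup_sigma_subadditive => // S' _.
have [PS'|/existsNP[n nPS']] := pselect (forall n, P n S').
  by rewrite indicE memNset//= ?normr0 ?nneseries_ge0// => -[].
apply: (le_trans _ (@nneseries_ge_term _ (fun n => `|(\1_(~` P n) S')%:E|%E) n _)) => //.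
rewrite !indicE (@mem_set _ (~` P n) S' nPS') /= lee_fin normr1.
by case: (_ \in _); rewrite ?normr0 ?normr1.
Qed.

End almost_everywhere.

Theorem proposition11 (R : realType) (M : market R)
  (neutral : locally_0_neutral M)
  (sigma0 : forall (j : nat) (S : trajs M), sigma_up j (fun _ => 0%E) S = 0%E)
  (j : nat)
  (sigma_Iup : forall f : trajs M -> \bar R,
     (forall S, (0 <= f S)%E) -> forall S, sigma_up j f S = Iup j f S)
  (f_ : nat -> trajs M -> \bar R)
  (f_int : forall n, cintegrable j (f_ n))
  (f_sum : forall S : trajs M, (\sum_(n <oo) cnorm j (f_ n) S < +oo)%E)
  (f : trajs M -> \bar R)
  (fE : forall (S : trajs M) (x : \bar R),
     sums_to (fun n => f_ n S) x -> f S = x) :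
  [/\ forall S : trajs M, ae_at S j [set S' | sums_to (fun n => f_ n S') (f S')],
      forall S : trajs M,
        cnorm j (fun S' => (psum (fun n => f_ n S') m - f S')%dE) S
          @[m --> \oo] --> 0%E,
      cintegrable j f &
      ae [set S | sums_to (fun n => cintegral j (f_ n) S) (cintegral j f S)]].
Proof.
have f_fE S S' x : agree S j S' -> sums_to (fun n => f_ n S') x -> f S' = x.
  by move=> _; exact: fE.
have all_int := ae_countable (sigma0 0%N) f_int.
have at_node S intS :=
  sigma_up_sums_to (sigma0 j S) (f_sum S) (f_fE S) (fun n => intS n I).
split=> [S|S||].
- exact: (ae_at_sums_to (sigma0 j S) (f_sum S) (@f_fE S)).
- exact: (cnorm_psum_cvg (sigma0 j S) (f_sum S) (@f_fE S)).
- by apply: (ae_sub (sigma0 0%N) _ all_int) => S /at_node[].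
- by apply: (ae_sub (sigma0 0%N) _ all_int) => S /at_node[].
Qed.
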